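(* Let $d$ be an abelian Dyck path, and let $G(d)$ be its indifference graph. Then for every integer $k\ge1$ the polynomial $X_{G(d)}(x_1,\ldots,x_k)$ is Lorentzian.
   Context: A Dyck path $d$ of length $n$ is a lattice path from $(0,0)$ to $(n,n)$ with steps $\mathsf{n}=(0,1)$ and $\mathsf{e}=(1,0)$ not going below $y=x$. Its Hessenberg function $h_d:[n]\to[n]$ is: $h_d(i)$ is the number of unit squares in column $i$ below $d$, i.e. the number of $\mathsf n$ steps preceding the $i$-th $\mathsf e$ step. The indifference graph $G(d)$ has vertex set $[n]=\{1,\dots,n\}$ with an edge between $i<j$ iff $j\le h_d(i)$. The path $d$ is abelian if $G(d)$ is co-bipartite, i.e. the complement of $G(d)$ is bipartite. For a graph $G$, $X_G(x_1,\ldots,x_k)=\sum_f\prod_{v\in V(G)}x_{f(v)}$, summed over all proper colorings $f:V(G)\to[k]$ (adjacent vertices get different colors). It is homogeneous of degree $|V(G)|$ (or zero). A set $J\subset\mathbb{N}^k$ is M-convex if for all $\alpha,\beta\in J$ and all $i$ with $\alpha_i>\beta_i$ there is $j$ with $\beta_j>\alpha_j$ and $\alpha-e_i+e_j\in J$, where $e_i$ are the standard unit vectors. A homogeneous polynomial $f\in\mathbb{R}[x_1,\ldots,x_k]$ of degree $n$ with nonnegative coefficients is Lorentzian if (i) its support (the set of exponent vectors with nonzero coefficient) is M-convex, and (ii) for all $i_1,\ldots,i_{n-2}\in[k]$, the quadratic form (equivalently the Hessian) of $\frac{\partial}{\partial x_{i_1}}\cdots\frac{\partial}{\partial x_{i_{n-2}}}f$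 has at most one positive eigenvalue. *)

(* Defs.v *)
From HB Require Import structures.
From mathcomp Require Import all_boot all_order all_algebra.
From mathcomp Require Import polyrcf mpoly reals.

Set Implicit Arguments.
Unset Strict Implicit.
Unset Printing Implicit Defensive.

Import Order.TTheory GRing.Theory Num.Theory.

Inductive step := North | East.

Definition is_north (s : step) : bool := if s is North then true else false.
Definition is_east (s : step) : bool := ~~ is_north s.

(* After p steps the path is at the point                                     *)
(*   (count is_east (take p w), count is_north (take p w)).                   *)
Record dyck_path (n : nat) := DyckPath {
  dyck_steps :> seq step;
  dyck_norths : count is_north dyck_steps = n;
  dyck_easts : count is_east dyck_steps = n;
  dyck_above : forall p : nat,
    count is_east (take p dyck_steps) <= count is_north (take p dyck_steps)
}.

(* Number of North steps preceding the East step of (0-based) rank i.         *)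
Fixpoint norths_before_east (w : seq step) (i : nat) : nat :=
  match w with
  | [::] => 0
  | North :: w' => (norths_before_east w' i).+1
  | East :: w' => if i is i'.+1 then norths_before_east w' i' else 0
  end.

(* Columns and vertices are numbered from 0: i : 'I_n stands for the element  *)
(* i + 1 of {1, ..., n}, so the condition j <= h_d(i) on 1-based labels       *)
(* becomes j < hessenberg d i below.                                          *)
Definition hessenberg n (d : dyck_path n) (i : 'I_n) : nat :=
  norths_before_east d i.

Definition indiff_graph n (d : dyck_path n) : rel 'I_n :=
  fun i j => (i < j) && (j < hessenberg d i) || (j < i) && (i < hessenberg d j).

Lemma indiff_graph_sym n (d : dyck_path n) : ssrbool.symmetric (indiff_graph d).
Proof. by move=> i j; rewrite /indiff_graph orbC. Qed.

Lemma indiff_graph_irrefl n (d : dyck_path n) : irreflexive (indiff_graph d).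
Proof. by move=> i; rewrite /indiff_graph ltnn. Qed.

Definition graph_compl (V : finType) (e : rel V) : rel V :=
  fun u v => (u != v) && ~~ e u v.

Definition bipartite (V : finType) (e : rel V) : Prop :=
  exists A : {set V}, forall u v : V, e u v -> (u \in A) != (v \in A).

Definition abelian_dyck n (d : dyck_path n) : Prop :=
  bipartite (graph_compl (indiff_graph d)).

Definition proper_coloring (V : finType) (e : rel V) k
    (f : {ffun V -> 'I_k}) : bool :=
  [forall u, forall v, e u v ==> (f u != f v)].

Local Open Scope ring_scope.

Definition chromatic_symmetric (R : realType) (V : finType) (e : rel V) k :
    {mpoly R[k]} :=
  \sum_(f : {ffun V -> 'I_k} | proper_coloring e f) \prod_(v : V) 'X_(f v).

(* The subtraction of exponent vectors is truncated, but it is only used with *)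
(* beta i < alpha i, hence 0 < alpha i.                                       *)
Definition M_convex k (J : {pred 'X_{1..k}}) : Prop :=
  forall alpha beta : 'X_{1..k}, alpha \in J -> beta \in J ->
  forall i : 'I_k, (beta i < alpha i)%N ->
  exists j : 'I_k, (alpha j < beta j)%N /\ (alpha - U_(i) + U_(j))%MM \in J.

(* For g homogeneous of degree 2 the second derivatives are constants, which  *)
(* are read off as coefficients of the trivial monomial.                      *)
Definition hessian (R : realType) k (g : {mpoly R[k]}) : 'M[R]_k :=
  \matrix_(i, j) (mderiv j (mderiv i g))@_0%MM.

(* Number of positive eigenvalues, counted with multiplicity.                 *)
Definition num_pos_eigenvalues (R : realType) k (A : 'M[R]_k) : nat :=
  (\sum_(a <- rootsR (char_poly A) | (0 < a)%R) mup a (char_poly A))%N.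

(* Homogeneity is that of mpoly, where 0 is homogeneous of every degree. For  *)
(* n < 2 the last clause is void.                                             *)
Definition lorentzian (R : realType) k (n : nat) (f : {mpoly R[k]}) : Prop :=
  [/\ f \is n.-homog,
      forall m : 'X_{1..k}, 0 <= f@_m,
      M_convex [pred m | f@_m != 0]
    & forall s : seq 'I_k, (size s).+2 = n ->
        (num_pos_eigenvalues
           (hessian (foldr (fun i g => mderiv i g) f s)) <= 1)%N].

(* Main.v *)
Require Import Defs.
From HB Require Import structures.
From mathcomp Require Import all_boot all_order all_algebra.
From mathcomp Require Import polyrcf mpoly reals.
From mathcomp Require Import complex zify ring lra.

(* Idea. The vertices of an abelian path split into two cliques A and B, and the
non-edges between them form a Ferrers board. A colouring with f(A) = S and
f(B) = T is a pair of bijections; the number of them depends only on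
i = #|S :&: T|, say it is t i. Adding the vertices in the order of the staircase
either adds an empty row to the board, t' i = (q + 1 - i) t i, or a full column,
t' i = (p + 1 - i) t i + i t (i - 1), and both steps preserve log-concavity.
Hence the coefficient of x^al, which vanishes unless al <= 2, satisfies
al! [x^al] X = s i, where i is the number of 2s in al and
s i = 2^i t i 'C(n - 2i, q - i), and with b = n - 2a - 2
  s (i + 1) <= s i  and  (b - 1) s (a + 2) s a <= b s (a + 1)^2.
Let g have a 2s and b 1s, let X and Y be the sums of the variables where g is 1
and 0, and Q and W the corresponding sums of squares. The Hessian form of the
g-th derivative is
  s (a + 2) (X^2 - Q) + 2 s (a + 1) X Y + s a Y^2 + (s (a + 1) - s a) W,
and the two inequalities and X^2 <= b Q make it nonpositive on the hyperplane
s (a + 1) X + s a Y = 0, so it has at most one positive eigenvalue. *)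

Set Implicit Arguments.
Unset Strict Implicit.
Unset Printing Implicit Defensive.

(** * Rook numbers of Ferrers boards *)

(** Here [t i] counts colourings whose two palettes share [i] colours, and [p] is the size of the
    second clique. Monotonicity excludes internal zeros, so that the log-concavity inequalities can
    be chained. *)
Definition rook_like (p : nat) (t : nat -> nat) : Prop :=
  [/\ forall i, t i.+1 <= t i,
      forall i, p < i -> t i = 0
    & forall i, t i * t i.+2 <= t i.+1 * t i.+1].

(** Multiply the inequalities at [i] and [i.+1] and cancel [t i.+1 * t i.+2]; if this product is
    zero, monotonicity forces [t i.+3 = 0]. *)
Lemma rook_like_gap p t i : rook_like p t -> t i * t i.+3 <= t i.+1 * t i.+2.
Proof.
case=> dec _ lc.
have [h|h] := posnP (t i.+1 * t i.+2).
  have -> : t i.+3 = 0 by have := dec i.+1; have := dec i.+2; nia.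
  by rewrite muln0.
rewrite -(leq_pmul2l h); have := leq_mul (lc i) (lc i.+1); nia.
Qed.

Lemma rook_like_nil : rook_like 0 (fun i => i == 0).
Proof. by split=> [i|[]|i]; rewrite //= muln0. Qed.

(** Log-concavity passes to termwise products, and the truncated linear sequence [q.+1 - i] is
    log-concave. *)
Lemma rook_like_row p q t :
  rook_like p t -> rook_like p (fun i => (q.+1 - i) * t i).
Proof.
move=> [dec zero lc]; split=> i.
- by apply: leq_mul => //; lia.
- by move=> /zero ->; rewrite muln0.
- rewrite mulnACA [leqRHS]mulnACA; apply: leq_mul => //.
  have [h|/ltnW h] := leqP q.+1 i.+1; first by have -> : q.+1 - i.+2 = 0; rewrite ?muln0 //; lia.
  have [k ->] : exists k, q = k + i by exists (q - i); lia.
  case: k {h} => [|k]; first by have -> : (0 + i).+1 - i.+2 = 0; rewrite ?muln0 //; lia.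
  have -> : (k.+1 + i).+1 - i = k.+2 by lia.
  have -> : (k.+1 + i).+1 - i.+1 = k.+1 by lia.
  have -> : (k.+1 + i).+1 - i.+2 = k by lia.
  nia.
Qed.

Lemma rook_like_column p t :
  rook_like p t -> rook_like p.+1 (fun i => (p.+1 - i) * t i + i * t i.-1).
Proof.
move=> rt; have [dec zero lc] := rt; split=> i.
- rewrite subSS /=; have [le_ip|lt_pi] := leqP i p; last first.
    by rewrite (zero i) // (zero i.+1) ?muln0 // leqW.
  have [k ->] : exists k, p = k + i by exists (p - i); lia.
  have -> : (k + i).+1 - i = k.+1 by lia.
  rewrite addnK; have := dec i.
  by case: i le_ip => [|i] _ /=; [|have := dec i]; nia.
- case: i => // i lt_pi; rewrite /= (zero i.+1) ?(zero i) //; lia.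
- rewrite !subSS /=; have [le_pi|lt_ip] := leqP p i.
    by rewrite (zero i.+2) ?(zero i.+1) ?muln0 //; lia.
  have [Q ->] : exists Q, p = (Q + i).+1 by exists (p - i.+1); lia.
  have -> : (Q + i).+2 - i = Q.+2 by lia.
  have -> : (Q + i).+1 - i = Q.+1 by lia.
  have -> : (Q + i).+1 - i.+1 = Q by lia.
  have xz := lc i.
  (* The factor [i] disposes of [i = 0], where [t i.-1] is [t 0] and not zero. *)
  have wy : i * (t i.-1 * t i.+1) <= i * (t i * t i).
    by case: (i) => //= j; rewrite leq_mul2l lc.
  have wz : i * (t i.-1 * t i.+2) <= i * (t i * t i.+1).
    by case: (i) => //= j; rewrite leq_mul2l (rook_like_gap _ rt).
  (* The claim is [(Q.+2 * x + i * w) * (Q * z + i.+2 * y) <= (Q.+1 * y + i.+1 * x) ^ 2]. Once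
     [x * z], [w * z] and [w * y] are replaced by [y * y], [x * y] and [x * x], the sides differ by
     exactly [(x - y) ^ 2]. *)
  move: (t i.-1) (t i) (t i.+1) (t i.+2) xz wy wz => w x y z xz wy wz.
  have h1 : (Q.+2 * Q) * (x * z) <= (Q.+2 * Q) * (y * y) by rewrite leq_mul2l xz orbT.
  have h2 : Q * (i * (w * z)) <= Q * (i * (x * y)) by rewrite leq_mul2l wz orbT.
  have h3 : i.+2 * (i * (w * y)) <= i.+2 * (i * (x * x)) by rewrite leq_mul2l wy orbT.
  have h4 : 2 * (x * y) <= x * x + y * y by rewrite !mulnn; exact: nat_Cauchy.
  nia.
Qed.

(** * Weights: monotonicity and corrected log-concavity *)

Lemma central_bin_rec u v :
  u.+1 * v.+1 * 'C((u + v).+2, v.+1) = (u + v).+2 * (u + v).+1 * 'C(u + v, v).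
Proof.
have /= e1 := mul_bin_diag (u + v).+2 v.
have /= e2 := mul_bin_down (u + v).+1 v; rewrite -addSn addnK addSn in e2.
by rewrite -mulnA -e1 mulnCA -e2 !mulnA.
Qed.

(* [2 ^ i] is the factorial of an exponent vector with [i] twos; the binomial
counts the palettes of size [q] that contain these [i] colours. *)
Definition weight p q (t : nat -> nat) i : nat :=
  if (i <= p) && (i <= q) then 2 ^ i * (t i * 'C(p + q - i.*2, q - i)) else 0.

(** Pascal's rule, applied twice, gives [2 * 'C(u + v, v) <= 'C((u + v).+2, v.+1)], which absorbs
    the additional factor 2. *)
Lemma weight_dec p q t i : rook_like p t -> weight p q t i.+1 <= weight p q t i.
Proof.
move=> [dec _ _]; rewrite /weight; case: ifP => // /andP[ip iq].
rewrite (ltnW ip) (ltnW iq) /=.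
have [u eu] : exists u, p = u + i.+1 by exists (p - i.+1); lia.
have [v ev] : exists v, q = v + i.+1 by exists (q - i.+1); lia.
have -> : p + q - i.+1.*2 = u + v by lia.
have -> : p + q - i.*2 = (u + v).+2 by lia.
have -> : q - i.+1 = v by lia.
have -> : q - i = v.+1 by lia.
rewrite expnS [2 * _]mulnC -mulnA leq_mul2l; apply/orP; right.
rewrite mulnCA leq_mul ?dec // !binS.
by case: v {ev} => [|v]; rewrite ?binS ?bin0 ?bin1; lia.
Qed.

(** The powers of 2 balance and [t] is log-concave. The binomials need not be, as 1, 2, 6 for
    [u = v = 0] shows; the outer coefficients make up for this. *)
Lemma weight_log_concave p q t a : rook_like p t ->
  (p + q - a.*2 - 3) * (weight p q t a.+2 * weight p q t a) <=
  (p + q - a.*2 - 2) * weight p q t a.+1 ^ 2.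
Proof.
move=> [_ _ lc]; rewrite /weight; case: ifP => [/andP[ip iq]|]; last by rewrite muln0.
have -> : (a <= p) && (a <= q) by lia.
have -> : (a < p) && (a < q) by lia.
have [u eu] : exists u, p = u + a.+2 by exists (p - a.+2); lia.
have [v ev] : exists v, q = v + a.+2 by exists (q - a.+2); lia.
have -> : p + q - a.+2.*2 = u + v by lia.
have -> : p + q - a.+1.*2 = (u + v).+2 by lia.
have -> : p + q - a.*2 = (u.+1 + v.+1).+2 by lia.
have -> : q - a.+2 = v by lia.
have -> : q - a.+1 = v.+1 by lia.
have -> : q - a = v.+2 by lia.
have -> : (u.+1 + v.+1).+2 - 3 = (u + v).+1 by lia.
have -> : (u.+1 + v.+1).+2 - 2 = (u + v).+2 by lia.
have e1 := central_bin_rec u v.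
have := central_bin_rec u.+1 v.+1; rewrite addSn addnS => e2.
move: ('C(u + v, v)) ('C((u + v).+2, v.+1)) ('C((u + v).+4, v.+2)) e1 e2.
move=> Z Y X e1 e2.
suff h : (u + v).+1 * (X * Z) <= (u + v).+2 * (Y * Y).
  have := leq_mul (lc a) h; rewrite -mulnn !expnS.
  by move=> /(leq_mul (leqnn (4 * 2 ^ a * 2 ^ a))); nia.
(* The denominators that arise when [X] and [Z] are expressed through [Y]. *)
have c_gt0 : 0 < u.+2 * v.+2 * ((u + v).+2 * (u + v).+1) by [].
rewrite -(leq_pmul2l c_gt0).
have -> : u.+2 * v.+2 * ((u + v).+2 * (u + v).+1) * ((u + v).+1 * (X * Z)) =
  (u + v).+1 * ((u.+2 * v.+2 * X) * ((u + v).+2 * (u + v).+1 * Z)) by nia.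
rewrite e2 -e1.
have h : (u + v).+4 * (u + v).+3 * (u.+1 * v.+1) <=
         (u + v).+2 * (u + v).+2 * (u.+2 * v.+2).
  have := nat_Cauchy u v; rewrite -!mulnn; nia.
have := leq_mul (leqnn ((u + v).+1 * (Y * Y))) h; nia.
Qed.

(** * Counting colourings *)

Section Colorings.
Variables (V C : finType) (e : rel V) (A : {set V}) (x0 : C).
Hypothesis e_sym : ssrbool.symmetric e.
Hypothesis e_irrefl : irreflexive e.
Hypothesis B_clique : {in ~: A &, forall u v, u != v -> e u v}.

Implicit Types (U : {set V}) (S T : {set C}) (f g : {ffun V -> C}).

(* Colourings of the subgraph induced on [U], extended by the dummy colour [x0]
outside [U]; [S] and [T] are the palettes of the two cliques. *)
Definition palette (U : {set V}) (S T : {set C}) (v : V) : {set C} :=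
  if v \in U then if v \in A then S else T else [set x0].

Definition coloring U S T (f : {ffun V -> C}) : bool :=
  [forall v, f v \in palette U S T v] &&
  [forall u, forall v, [&& u \in U, v \in U & e u v] ==> (f u != f v)].

Lemma coloringP U S T f :
  reflect ((forall v, f v \in palette U S T v) /\
           {in U &, forall u v, e u v -> f u != f v})
          (coloring U S T f).
Proof.
apply: (iffP andP) => [[/forallP fP /forallP fU]|[fP fU]]; split=> //.
- by move=> u v uU vU euv; have /forallP/(_ v) := fU u; rewrite uU vU euv.
- exact/forallP.
- apply/forallP => u; apply/forallP => v; apply/implyP => /and3P[? ? ?].
  exact: fU.
Qed.

Definition update (v : V) (s : C) (f : {ffun V -> C}) : {ffun V -> C} :=
  [ffun u => if u == v then s else f u].

(** Recolouring [v] by [s] undoes the deletion of [v]. It is injective because the dummy colour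
    fixes the value at [v] of every colouring of [U :\ v]. *)
Lemma card_coloring_update U S T S' T' v s : v \in U ->
  (forall g, coloring (U :\ v) S' T' g -> coloring U S T (update v s g)) ->
  (forall f, coloring U S T f -> f v = s ->
             coloring (U :\ v) S' T' (update v x0 f)) ->
  #|[set f | coloring U S T f & f v == s]| =
  #|[set g | coloring (U :\ v) S' T' g]|.
Proof.
move=> vU extend restrict; rewrite -[RHS](card_in_imset (f := update v s)).
  apply: eq_card => f; rewrite inE; apply/andP/imsetP => [[fc /eqP fv]|[g]].
    exists (update v x0 f); first by rewrite inE restrict.
    by apply/ffunP => u; rewrite !ffunE; case: eqVneq => // ->.
  by rewrite inE => /extend gc ->; rewrite gc ffunE eqxx.
move=> g h; rewrite !inE => /coloringP[gP _] /coloringP[hP _] /ffunP gh.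
apply/ffunP => u; have := gh u; rewrite !ffunE; case: eqVneq => // -> _.
by have := gP v; have := hP v; rewrite /palette !inE eqxx /= => /set1P-> /set1P->.
Qed.

Lemma card_coloring_split U S T v :
  #|[set f | coloring U S T f]| =
  \sum_s #|[set f | coloring U S T f & f v == s]|.
Proof.
rewrite -sum1_card (partition_big (fun f : {ffun V -> C} => f v) predT) //=.
by apply: eq_bigr => s _; rewrite -sum1_card; apply: eq_bigl => f; rewrite !inE.
Qed.

Lemma coloring_extend U S T S' T' v s g : v \in U ->
  s \in palette U S T v -> S' \subset S -> T' \subset T ->
  (forall u c, u \in U :\ v -> e u v -> c \in palette (U :\ v) S' T' u -> c != s) ->
  coloring (U :\ v) S' T' g -> coloring U S T (update v s g).
Proof.
move=> vU sP S'S T'T sN /coloringP[gP gU]; apply/coloringP; split=> [u|u w uU wU].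
  rewrite ffunE; case: eqVneq => [->//|uv]; have := gP u.
  rewrite /palette !inE uv /=; case: ifP => // uU.
  by case: ifP => _; [exact: (subsetP S'S)|exact: (subsetP T'T)].
rewrite !ffunE; case: (eqVneq u v) => [->|uv]; case: (eqVneq w v) => [->|wv];
  rewrite ?e_irrefl // => euw.
- by rewrite eq_sym (sN w) ?inE ?wv // e_sym.
- by rewrite (sN u) ?inE ?uv.
- by apply: gU; rewrite ?inE ?uv ?wv.
Qed.

Lemma coloring_restrict U S T S' T' v f : v \in U ->
  coloring U S T f ->
  (forall u, u \in U :\ v -> f u \in palette U S' T' u) ->
  coloring (U :\ v) S' T' (update v x0 f).
Proof.
move=> vU /coloringP[fP fU] f'P; apply/coloringP; split=> [u|u w].
  rewrite ffunE; case: eqVneq => [->|uv]; first by rewrite /palette !inE eqxx inE.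
  have [uU|uU] := boolP (u \in U); last first.
    by have := fP u; rewrite /palette !inE (negPf uU) andbF.
  by have := f'P u; rewrite /palette !inE uv uU /=; apply.
rewrite !inE !ffunE => /andP[/negPf-> uU] /andP[/negPf-> wU]; exact: fU.
Qed.

(** A clique receives distinct colours, so a palette of its size is used up. *)
Lemma coloring_image U S T (f : {ffun V -> C}) : coloring U S T f -> #|T| = #|U :\: A| ->
  f @: (U :\: A) = T.
Proof.
move=> /coloringP[fP fU] cT; apply/eqP; rewrite eqEcard; apply/andP; split.
  apply/subsetP => _ /imsetP[u uU ->]; have := fP u.
  by move: uU; rewrite /palette inE => /andP[/negPf-> ->].
rewrite cT card_in_imset // => u w; rewrite !inE => /andP[uA uU] /andP[wA wU] fuw.
apply/eqP; apply: contraPT fuw => uw; apply/eqP; apply: fU => //.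
by apply: B_clique; rewrite ?inE.
Qed.

(** The colour of [v] occurs nowhere else, and all of [T] is taken by the second clique, so the
    choices for [v] are the colours of [S :\: T]. *)
Lemma card_coloring_row U S T v : v \in U -> v \in A ->
  {in U, forall u, u != v -> e u v} -> #|T| = #|U :\: A| ->
  #|[set f | coloring U S T f]| =
  \sum_(s in S :\: T) #|[set g | coloring (U :\ v) (S :\ s) T g]|.
Proof.
move=> vU vA v_dom cT; rewrite (card_coloring_split _ _ _ v) [RHS]big_mkcond /=.
apply: eq_bigr => s _; case: ifPn => [|sST].
  rewrite inE => /andP[sT sS]; apply: card_coloring_update => // [g|f fc fv].
    apply: coloring_extend; rewrite ?subD1set // /palette ?vU ?vA //.
    move=> u c; rewrite !inE => /andP[-> ->] _ /=; case: ifP => _.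
      by rewrite !inE => /andP[].
    by apply: contraTneq => ->.
  apply: (coloring_restrict vU fc) => u; rewrite !inE => /andP[uv uU].
  have /coloringP[fP fU] := fc; have := fP u; rewrite /palette uU.
  by case: ifP => // uA fu; rewrite !inE fu andbT -fv fU // v_dom.
apply: eq_card0 => f; rewrite inE; apply/andP => -[fc /eqP fv].
have /coloringP[fP fU] := fc; case/negP: sST; rewrite inE -{2}fv.
have := fP v; rewrite /palette vU vA => ->; rewrite andbT.
rewrite -(coloring_image fc cT) -fv; apply/imsetP => -[u].
rewrite inE => /andP[uA uU] /eqP; apply/negP; rewrite eq_sym fU // v_dom //.
by apply: contraNneq uA => ->.
Qed.

(** In [U], only the second clique constrains the colour of [v]: any colour of [T] is allowed, and
    [S] stays whole. *)
Lemma card_coloring_column U S T v : v \in U -> v \notin A ->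
  {in U, forall u, u \in A -> ~~ e u v} ->
  #|[set f | coloring U S T f]| =
  \sum_(s in T) #|[set g | coloring (U :\ v) S (T :\ s) g]|.
Proof.
move=> vU vA v_free; rewrite (card_coloring_split _ _ _ v) [RHS]big_mkcond /=.
apply: eq_bigr => s _; case: ifPn => sT.
  apply: card_coloring_update => // [g|f fc fv].
    apply: coloring_extend; rewrite ?subD1set // /palette ?vU ?(negPf vA) //.
    move=> u c; rewrite !inE => /andP[-> uU] euv; rewrite uU /=; case: ifPn => uA.
      by have := v_free _ uU uA; rewrite euv.
    by rewrite !inE => /andP[].
  apply: (coloring_restrict vU fc) => u; rewrite !inE => /andP[uv uU].
  have /coloringP[fP fU] := fc; have := fP u; rewrite /palette uU.
  case: ifPn => // uA fu; rewrite !inE fu andbT -fv fU // B_clique ?inE //.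
apply: eq_card0 => f; rewrite inE; apply/andP => -[/coloringP[fP _] /eqP fv].
by have := fP v; rewrite /palette vU (negPf vA) fv; apply/negP.
Qed.

(** Every induced subgraph has a vertex whose row in the board of non-edges is empty or whose column
    is full. *)
Hypothesis peel : forall U : {set V}, U != set0 -> exists2 v, v \in U &
  if v \in A then {in U, forall u, u != v -> e u v}
  else {in U, forall u, u \in A -> ~~ e u v}.

(* [t #|S :&: T|] depends only on the size of [S :&: T] since the colourings
with palettes [S] and [T] are the pairs of bijections whose colour classes are
independent. *)
Lemma card_coloring_rook (U : {set V}) : exists2 t : nat -> nat,
  rook_like #|U :\: A| t &
  forall S T : {set C}, #|S| = #|U :&: A| -> #|T| = #|U :\: A| ->
    #|[set f | coloring U S T f]| = t #|S :&: T|.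
Proof.
have [m] := ubnP #|U|; elim: m U => // m IHm U; rewrite ltnS => leU.
have [->|U_n0] := eqVneq U set0.
  rewrite set0D set0I cards0.
  exists (fun i => i == 0) => [|S T /eqP]; first exact: rook_like_nil.
  rewrite cards_eq0 => /eqP-> /eqP; rewrite cards_eq0 => /eqP->.
  rewrite setI0 cards0 /=; apply/eqP/cards1P; exists [ffun=> x0].
  apply/setP => f; rewrite !inE; apply/coloringP/eqP => [[fP _]|->].
    apply/ffunP => v; rewrite ffunE; apply/set1P.
    by have := fP v; rewrite /palette in_set0.
  by split=> [v|u v]; rewrite ?ffunE /palette ?in_set0 ?set11.
have [v vU v_peel] := peel U_n0.
have [|t rt tP] := IHm (U :\ v); first by have := cardsD1 v U; rewrite vU; lia.
have eUA : (v \in A) + #|(U :\ v) :&: A| = #|U :&: A|.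
  by rewrite [RHS](cardsD1 v) inE vU setIDAC.
have eUB : (v \notin A) + #|(U :\ v) :\: A| = #|U :\: A|.
  by rewrite [RHS](cardsD1 v) inE vU andbT !setDDl setUC.
case: ifP v_peel eUA eUB => [vA v_dom|/negbT vA v_free] /= eUA eUB.
  rewrite add0n in eUB; rewrite -eUB -eUA.
  exists (fun i => (#|(U :\ v) :&: A|.+1 - i) * t i); first exact: rook_like_row.
  move=> S T cS cT; rewrite (card_coloring_row _ vU) ?cT //.
  rewrite (eq_bigr (fun=> t #|S :&: T|)) => [|s].
    by rewrite sum_nat_const cardsD cS add1n.
  rewrite inE => /andP[sT sS]; rewrite tP //.
    congr t; apply: eq_card => c; rewrite !inE.
    by case: eqVneq => /= [->|]; rewrite ?(negPf sT) ?andbF.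
  by have := cardsD1 s S; rewrite sS cS; lia.
rewrite add0n in eUA; rewrite -eUB -eUA.
exists (fun i => (#|(U :\ v) :\: A|.+1 - i) * t i + i * t i.-1); first exact: rook_like_column.
move=> S T cS cT; rewrite (card_coloring_column _ _ vU) //.
have cTs s : s \in T -> #|T :\ s| = #|(U :\ v) :\: A|.
  by move=> sT; have := cardsD1 s T; rewrite sT cT; lia.
(* Deleting a colour outside [S] keeps the overlap and deleting one of [S :&: T] lowers it by one;
   these are the two terms of the column recurrence. *)
rewrite (big_setID S) /= addnC; congr (_ + _).
  rewrite (eq_bigr (fun=> t #|S :&: T|)) => [|s].
    by rewrite sum_nat_const cardsD cT add1n setIC.
  rewrite inE => /andP[sS sT]; rewrite tP ?cTs //.
  by congr t; apply: eq_card => c; rewrite !inE; case: eqVneq => // ->; rewrite (negPf sS).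
rewrite (eq_bigr (fun=> t #|S :&: T|.-1)) => [|s]; first by rewrite sum_nat_const setIC.
rewrite inE => /andP[sT sS]; rewrite tP ?cTs //.
by rewrite [in RHS](cardsD1 s) inE sS sT setIDA.
Qed.

End Colorings.

(** [S] is determined by [S :\: D], an arbitrary subset of [E] of size [q - #|D|]. *)
Lemma card_between (C : finType) (D E : {set C}) q : [disjoint D & E] ->
  #|[set S : {set C} | [&& D \subset S, S \subset D :|: E & #|S| == q]]| =
  if #|D| <= q then 'C(#|E|, q - #|D|) else 0.
Proof.
move=> DE; case: ifP => Dq; last first.
  apply: eq_card0 => S; rewrite inE; apply/and3P => -[/subset_leq_card + _ /eqP cS].
  by rewrite cS Dq.
rewrite -cards_draws -[RHS](card_in_imset (f := fun B => D :|: B)).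
  apply: eq_card => S; rewrite inE; apply/and3P/imsetP => [[DS SDE /eqP cS]|[B]].
    exists (S :\: D); last by rewrite -[LHS](setID S D) (setIidPr DS).
    by rewrite inE subDset SDE cardsD (setIidPr DS) cS /=.
  rewrite inE => /andP[BE /eqP cB] ->; rewrite subsetUl setUS //; split=> //.
  have DB : [disjoint D & B] by apply: disjointWr DE.
  by have [_] := leq_card_setU D B; rewrite DB => /eqP->; rewrite cB subnKC.
move=> B B'; rewrite !inE => /andP[BE _] /andP[B'E _] eBB.
have BD (X : {set C}) : X \subset E -> (D :|: X) :\: D = X.
  move=> XE; rewrite setDUl setDv set0U; apply/setDidPl.
  by rewrite disjoint_sym; apply: disjointWr DE.
by rewrite -(BD B) // eBB BD.
Qed.

(** * Proper colourings with prescribed exponents *)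

Section Contents.
Variables (V C : finType) (e : rel V) (A : {set V}) (x0 : C).
Hypothesis e_sym : ssrbool.symmetric e.
Hypothesis e_irrefl : irreflexive e.
Hypothesis A_clique : {in A &, forall u v, u != v -> e u v}.
Hypothesis B_clique : {in ~: A &, forall u v, u != v -> e u v}.
Hypothesis peel : forall U : {set V}, U != set0 -> exists2 v, v \in U &
  if v \in A then {in U, forall u, u != v -> e u v}
  else {in U, forall u, u \in A -> ~~ e u v}.

(** The exponent of the variable of [c] in the monomial of [f]. *)
Definition content (f : V -> C) (c : C) : nat := #|[set v | f v == c]|.

Definition level (al : C -> nat) (i : nat) : {set C} := [set c | al c == i].

Lemma sum_content f : \sum_c content f c = #|V|.
Proof.
rewrite -sum1_card (partition_big f predT) //=; apply: eq_bigr => c _.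
by rewrite /content -sum1_card; apply: eq_bigl => v; rewrite inE.
Qed.

Lemma sum_level (al : C -> nat) : (forall c, al c <= 2) ->
  \sum_c al c = #|level al 1| + 2 * #|level al 2|.
Proof.
move=> al2; rewrite mulnC -sum_nat_const -sum1_card.
rewrite [X in X + _]big_mkcond [X in _ + X]big_mkcond -big_split.
by apply: eq_bigr => c _ /=; rewrite !inE; case: (al c) (al2 c) => [|[|[|]]].
Qed.

Lemma proper_coloringP (f : {ffun V -> C}) : reflect
  (forall u v, e u v -> f u != f v) [forall u, forall v, e u v ==> (f u != f v)].
Proof.
apply: (iffP forallP) => [fP u v|fP u]; first by have /forallP/(_ v)/implyP := fP u.
by apply/forallP => v; apply/implyP; exact: fP.
Qed.

Local Notation proper f := [forall u, forall v, e u v ==> (f u != f v)].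

Lemma content_clique (f : {ffun V -> C}) (K : {set V}) c : proper f ->
  {in K &, forall u v, u != v -> e u v} ->
  #|[set v in K | f v == c]| = (c \in f @: K).
Proof.
move=> /proper_coloringP fP K_clique; case: imsetP => [[v vK ->]|cN].
  apply/eqP/cards1P; exists v; apply/setP => u; rewrite !inE.
  apply/andP/eqP => [[uK /eqP fuv]|->]; last by rewrite vK.
  by apply: contra_eq fuv => uv; apply: fP; exact: K_clique.
apply: eq_card0 => v; rewrite inE; apply/andP => -[vK /eqP fv].
by case: cN; exists v.
Qed.

(** Each of the two cliques uses a colour at most once, so all exponents are at most 2. *)
Lemma contentE (f : {ffun V -> C}) c : proper f ->
  content f c = (c \in f @: A) + (c \in f @: (~: A)).
Proof.
move=> f_proper; rewrite -!content_clique // /content -cardsUI.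
rewrite -[LHS]addn0; congr (_ + _).
  by apply: eq_card => v; rewrite !inE; case: (v \in A); rewrite /= ?orbF.
by apply/esym/eq_card0 => v; rewrite !inE; case: (v \in A); rewrite /= ?andbF.
Qed.

Lemma card_proper_clique (f : {ffun V -> C}) (K : {set V}) : proper f ->
  {in K &, forall u v, u != v -> e u v} -> #|f @: K| = #|K|.
Proof.
move=> /proper_coloringP fP K_clique; apply: card_in_imset => u v uK vK fuv.
by apply: contra_eq fuv => uv; apply: fP; exact: K_clique.
Qed.

Lemma coloring_setT (S T : {set C}) (f : {ffun V -> C}) : #|S| = #|A| -> #|T| = #|~: A| ->
  coloring e A x0 setT S T f = [&& proper f, f @: A == S & f @: (~: A) == T].
Proof.
move=> cS cT; apply/coloringP/and3P => [[fP fU]|[/proper_coloringP fP /eqP<- /eqP<-]].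
  have f_proper : proper f by apply/proper_coloringP => u v euv; rewrite fU.
  split=> //; rewrite eqEcard ?cS ?cT card_proper_clique // leqnn andbT.
    apply/subsetP => _ /imsetP[u uA ->]; have := fP u.
    by rewrite /palette in_setT uA.
  apply/subsetP => _ /imsetP[u uA ->]; have := fP u; move: uA.
  by rewrite /palette in_setT in_setC => /negPf->.
split=> [v|u v _ _]; last exact: fP.
rewrite /palette in_setT; case: ifPn => vA; first exact: imset_f.
by rewrite imset_f // in_setC.
Qed.

(** Sort the colourings by [S = f @: A]. This set contains the colours of exponent 2 and otherwise
    only colours of exponent 1, and it determines the other palette. The overlap is always
    [level al 2], so each such [S] contributes the same number. *)
Lemma card_proper_content : exists2 t, rook_like #|~: A| t &
  forall al : C -> nat,
    #|[set f : {ffun V -> C} | proper f & [forall c, content f c == al c]]| =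
    if [forall c, al c <= 2] && (\sum_c al c == #|V|) then
      if (#|level al 2| <= #|~: A|) && (#|level al 2| <= #|A|)
      then t #|level al 2| *
           'C(#|~: A| + #|A| - #|level al 2|.*2, #|A| - #|level al 2|)
      else 0
    else 0.
Proof.
have [t rt tP] := card_coloring_rook x0 e_sym e_irrefl B_clique peel setT.
have eA : setT :&: A = A by rewrite setTI.
have eB : setT :\: A = ~: A by rewrite setTD.
rewrite eB in rt; rewrite eA eB in tP.
exists t => // al; set D := level al 2; pose E := level al 1.
case: ifPn => [/andP[/forallP al2 /eqP al_sum]|alN]; last first.
  apply: eq_card0 => f; rewrite inE; apply/negP => /andP[f_proper /forallP f_al].
  case/negP: alN; rewrite -(sum_content f); apply/andP; split.
    by apply/forallP => c; rewrite -(eqP (f_al c)) contentE // (leq_add (leq_b1 _) (leq_b1 _)).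
  by apply/eqP/eq_bigr => c _; rewrite (eqP (f_al c)).
have DE : [disjoint D & E].
  by rewrite -setI_eq0; apply/eqP/setP => c; rewrite !inE; case: eqP => // ->.
have cAB : #|~: A| + #|A| = #|V| by rewrite addnC cardsC.
have cE : #|E| = #|~: A| + #|A| - #|D|.*2.
  by rewrite cAB -al_sum sum_level // -/D -/E mul2n addnK.
transitivity (\sum_(S in [set S : {set C} |
    [&& D \subset S, S \subset D :|: E & #|S| == #|A|]]) t #|D|).
  rewrite -sum1_card (partition_big (fun f : {ffun V -> C} => f @: A) predT) //=.
  rewrite [RHS]big_mkcond; apply: eq_bigr => S _ /=; rewrite inE.
  case: ifPn => [/and3P[DS SDE /eqP cS]|SN].
    have inD c : (c \in D) = (al c == 2) by rewrite inE.
    have inE' c : (c \in E) = (al c == 1) by rewrite inE.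
    (* The second palette: the colours of exponent 2 and those of exponent 1 left over by [S]. *)
    have [T inT] : exists T : {set C}, forall c,
        (c \in T) = (al c == 2) || (c \notin S) && (al c == 1).
      by exists (D :|: E :\: S) => c; rewrite !inE.
    have al_S c : c \in S -> al c != 0.
      by move=> /(subsetP SDE); rewrite !inE => /orP[]/eqP->.
    have S_al c : al c = 2 -> c \in S.
      by move=> alc; apply: (subsetP DS); rewrite inE alc.
    have al_ST c : al c = (c \in S) + (c \in T).
      rewrite inT; have := al_S c; have := S_al c.
      by case: (al c) (al2 c) => [|[|[|]]] // _; case: (c \in S) => //; intuition.
    have ST : S :&: T = D.
      apply/setP => c; rewrite in_setI inD al_ST.
      by case: (c \in S); case: (c \in T).
    have cT : #|T| = #|~: A|.
      apply/eqP; rewrite -(eqn_add2l #|S|) {2}cS cardsC -al_sum -cardsUI ST.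
      have -> : S :|: T = D :|: E.
        apply/setP => c; rewrite !in_setU inD inE' al_ST.
        by case: (c \in S); case: (c \in T).
      rewrite sum_level // -/D -/E.
      by have [_] := leq_card_setU D E; rewrite DE => /eqP->; apply/eqP; lia.
    rewrite -ST -tP // -sum1_card; apply: eq_bigl => f; rewrite !inE coloring_setT //.
    rewrite -andbA; case: (boolP (proper f)) => //= f_proper.
    apply/andP/andP => [[/forallP f_al /eqP fS]|[/eqP fS /eqP fT]]; split=> //.
    - by rewrite fS.
    - apply/eqP/setP => c; have := f_al c; rewrite contentE // fS al_ST eqn_add2l.
      by case: (_ \in _); case: (_ \in _).
    - by apply/forallP => c; rewrite contentE // fS fT al_ST.
    - by rewrite fS.
  rewrite big_pred0 // => f; apply: contraNF SN; rewrite inE.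
  move=> /andP[/andP[f_proper /forallP f_al] /eqP<-].
  rewrite card_proper_clique // eqxx andbT; apply/andP; split.
    apply/subsetP => c; rewrite inE -(eqP (f_al c)) contentE //.
    by case: (c \in f @: A); case: (c \in f @: (~: A)).
  apply/subsetP => c cA; rewrite !inE -(eqP (f_al c)) contentE // cA.
  by case: (c \in f @: (~: A)).
rewrite sum_nat_const card_between // -/D cE.
case: (leqP #|D| #|A|) => DA; rewrite ?andbF ?mul0n // andbT.
case: ifPn => DB; first by rewrite mulnC.
have [_ zero _] := rt; by rewrite zero ?muln0 // ltnNge.
Qed.
End Contents.

(** * Positive eigenvalues *)

Import Order.TTheory GRing.Theory Num.Theory.
Local Open Scope ring_scope.

Lemma char_poly_similar (K : fieldType) k (P D : 'M[K]_k) :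
  P \in unitmx -> char_poly (invmx P *m D *m P) = char_poly D.
Proof.
move=> Pu; rewrite /char_poly.
have QP1 : map_mx polyC (invmx P) *m map_mx polyC P = 1%:M.
  by rewrite -map_mxM mulVmx // map_mx1.
have -> : char_poly_mx (invmx P *m D *m P) =
          map_mx polyC (invmx P) *m char_poly_mx D *m map_mx polyC P.
  rewrite /char_poly_mx !map_mxM mulmxBr mulmxBl.
  by rewrite scalar_mxC -['X%:M *m _ *m _]mulmxA QP1 mulmx1.
by rewrite !det_mulmx mulrAC -det_mulmx QP1 det1 mul1r.
Qed.

(** The list of roots has no duplicates, so after exchanging the sums each positive entry of [s] is
    counted at most once. *)
Lemma num_pos_eigenvalues_prod (R : realType) k (A : 'M[R]_k) (s : seq R) :
  char_poly A = \prod_(a <- s) ('X - a%:P) ->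
  (num_pos_eigenvalues A <= count (fun a => (0 < a)%R) s)%N.
Proof.
move=> chA; rewrite /num_pos_eigenvalues chA.
under eq_bigr do rewrite mu_prod_XsubC.
have : uniq (rootsR (\prod_(a <- s) ('X - a%:P))) by exact: uniq_roots.
move: (rootsR _) => r r_uniq.
under eq_bigr do rewrite -sum1_count.
rewrite -sum1_count (exchange_big_dep predT) //= [leqRHS]big_mkcond /=.
apply: leq_sum => a _; rewrite sum1_count.
case: ifPn => [_|a_le0]; last first.
  rewrite leqn0 -leqn0 leqNgt -has_count; apply/hasPn => b _ /=.
  by apply: contra a_le0 => /andP[? /eqP->].
apply: leq_trans (_ : (count_mem a r <= 1)%N); last by rewrite count_uniq_mem // leq_b1.
by apply: sub_count => b /= /andP[_]; rewrite eq_sym.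
Qed.

Section Spectral.
Local Open Scope sesquilinear_scope.
Local Open Scope complex_scope.
Variables (R : realType) (k : nat) (A : 'M[R]_k) (w : 'rV[R]_k).
Hypothesis A_sym : A^T = A.
Hypothesis A_le0 :
  forall x : 'rV_k, x *m w^T = 0 -> (x *m A *m x^T) 0 0 <= 0.

Local Notation toC := (real_complex R).
Local Notation AC := (map_mx toC A).
Local Notation P := (spectralmx AC).

(** As [w] is real, the real and imaginary parts of [u] both lie on the hyperplane; by symmetry of
    [A] the value is the sum of the values of the real form at these parts. *)
Lemma complex_form_le0 (u : 'rV[R[i]]_k) :
  u *m (map_mx toC w)^T = 0 -> complex.Re ((u *m AC *m u^t*) 0 0) <= 0.
Proof.
pose x := map_mx (@complex.Re R) u; pose y := map_mx (@complex.Im R) u.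
have uE : u = map_mx toC x + 'i *: map_mx toC y.
  by apply/rowP => j; rewrite !mxE; exact: complexE.
have uJ : u^t* = (map_mx toC x)^T - 'i *: (map_mx toC y)^T.
  apply/colP => j; rewrite !mxE; case: (u 0 j) => a b.
  by apply/eqP; rewrite eq_complex /=; apply/andP; split; apply/eqP; ring.
have mapR (a b : 'rV[R]_k) :
    map_mx toC a *m AC *m (map_mx toC b)^T = map_mx toC (a *m A *m b^T).
  by rewrite map_trmx -!map_mxM.
have sym_xy : x *m A *m y^T = y *m A *m x^T.
  have tr11 (M : 'M[R]_1) : M^T = M by apply/matrixP => i j; rewrite !ord1 mxE.
  by rewrite -[LHS]tr11 !trmx_mul trmxK A_sym mulmxA.
move=> uw.
have [xw yw] : x *m w^T = 0 /\ y *m w^T = 0.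
  move: uw; rewrite uE mulmxDl -scalemxAl map_trmx -!map_mxM.
  move=> /matrixP/(_ 0 0); rewrite !mxE => /eqP; rewrite eq_complex /=.
  rewrite !mul0r !mul1r !subr0 addr0 !add0r => /andP[/eqP e1 /eqP e2].
  by split; apply/matrixP => i j; rewrite !ord1 !mxE.
rewrite uJ {1}uE mulmxDl -scalemxAl mulmxBr !mulmxDl -!scalemxAr -!scalemxAl !mapR.
rewrite sym_xy !mxE /=.
have := lerD (A_le0 xw) (A_le0 yw); rewrite addr0; apply: le_trans.
rewrite !mxE.
by rewrite le_eqVlt; apply/orP; left; apply/eqP; ring.
Qed.

(** Two eigenvectors with positive eigenvalues would span a plane on which the Hermitian form is
    positive definite, yet this plane meets the hyperplane of [w] nontrivially. *)
Lemma num_pos_eigenvalues_le1 : (num_pos_eigenvalues A <= 1)%N.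
Proof.
have AC_herm : AC \is hermsymmx.
  apply: realsym_hermsym.
    by apply/is_hermitianmxP; rewrite expr0 scale1r map_mx_id // map_trmx A_sym.
  by apply/mxOverP => i j; rewrite mxE complex_real.
have /orthomx_spectralP ACE := hermitian_normalmx AC_herm.
have P_unit : P \in unitmx := spectral_unit AC.
pose e i := complex.Re (spectral_diag AC 0 i).
have eE i : spectral_diag AC 0 i = toC (e i).
  by rewrite RRe_real //; apply: (mxOverP (hermitian_spectral_diag_real AC_herm)).
have chA : char_poly A = \prod_(a <- [seq e i | i <- enum 'I_k]) ('X - a%:P).
  apply: (@map_poly_inj _ _ toC); rewrite map_char_poly ACE.
  rewrite char_poly_similar // char_poly_trig ?diag_mx_is_trig //.
  rewrite rmorph_prod big_map enumT /=; apply: eq_bigr => i _.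
  by rewrite !mxE eqxx mulr1n eE rmorphB /= map_polyX map_polyC.
apply: leq_trans (num_pos_eigenvalues_prod chA) _.
rewrite count_map -size_filter leqNgt; apply/negP.
set s := filter _ _ => s_gt1.
have s_uniq : uniq s by rewrite filter_uniq // enum_uniq.
have [i [j [ij ei ej]]] : exists i j, [/\ i != j, 0 < e i & 0 < e j].
  have mem_s l : l \in s -> 0 < e l by rewrite mem_filter /= => /andP[].
  case: s s_gt1 s_uniq mem_s => [|i [|j s]] //= _ /andP[ij _] mem_s.
  exists i, j; split; [|exact/mem_s/mem_head|apply: mem_s; rewrite !inE eqxx orbT //].
  by apply: contraNneq ij => ->; rewrite mem_head.
pose c l := (row l P *m (map_mx toC w)^T) 0 0.
(* A nonzero combination of the two eigenvectors [row i P] and [row j P] on the hyperplane. *)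
have [a [b [ab0 ab]]] :
    exists a b : R[i], (a != 0) || (b != 0) /\ a * c i + b * c j = 0.
  have [cj0|cj0] := eqVneq (c j) 0.
    by exists 0, 1; rewrite oner_eq0 orbT cj0 mul0r mulr0 addr0.
  by exists (c j), (- c i); rewrite cj0; split=> //; ring.
pose v : 'rV[R[i]]_k := a *: delta_mx 0 i + b *: delta_mx 0 j.
have /complex_form_le0 : v *m P *m (map_mx toC w)^T = 0.
  rewrite !mulmxDl -!scalemxAl -!rowE; apply/matrixP => x y.
  by rewrite !ord1 !mxE; rewrite /c !mxE in ab.
have P_inv : invmx P = P^t* by rewrite invmx_unitary // spectral_unitarymx.
rewrite [X in fun_of_matrix X](_ : _ = v *m diag_mx (spectral_diag AC) *m v^t*); last first.
  have -> : diag_mx (spectral_diag AC) = P *m AC *m invmx P.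
    by rewrite {3}ACE !mulmxA mulmxV // mul1mx mulmxK.
  by rewrite trmx_mul map_mxM /= -P_inv !mulmxA.
apply/negP; rewrite -ltNge.
suff : 0 < (v *m diag_mx (spectral_diag AC) *m v^t*) 0 0 by rewrite ltcE => /andP[].
have vE l : v 0 l = a *+ (l == i) + b *+ (l == j).
  by rewrite !mxE eqxx !mulr_natr.
rewrite mul_mx_diag mxE (bigD1 i) //= (bigD1 j) 1?eq_sym //= big1 => [|l /andP[li lj]].
  have term l : (\matrix_(i0, j0) (v i0 j0 * spectral_diag AC 0 j0)) 0 l * v^t* l 0 =
      toC (e l) * `|v 0 l| ^+ 2.
    by rewrite normCK !mxE eE; ring.
  rewrite !term !vE !eqxx (negPf ij) [j == i]eq_sym (negPf ij) !mulr1n !mulr0n !addr0 add0r.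
  have [a0 b0] : 0 <= `|a| ^+ 2 /\ 0 <= `|b| ^+ 2 by rewrite !exprn_ge0.
  have [ei' ej'] : 0 < toC (e i) /\ 0 < toC (e j) by rewrite !ltcR.
  case/orP: ab0 => h.
    by rewrite ltr_pwDl ?mulr_gt0 ?exprn_gt0 ?normr_gt0 // mulr_ge0 // ltW.
  by rewrite ltr_wpDl ?mulr_gt0 ?exprn_gt0 ?normr_gt0 // mulr_ge0 // ltW.
by rewrite !mxE (negPf li) (negPf lj) !mulr0 addr0 !mul0r.
Qed.

End Spectral.

(** * Polynomials with exponents at most two *)

Section NormalizedCoefficients.
Variables (R : realType) (k : nat).
Implicit Types (f : {mpoly R[k]}) (m : 'X_{1..k}).

Definition mnm_fact m : nat := (\prod_i (m i)`!)%N.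

(** With the factorials included, differentiation merely shifts exponents. *)
Definition ncoeff f m : R := f@_m *+ mnm_fact m.

Lemma mnm_fact_gt0 m : (0 < mnm_fact m)%N.
Proof. by apply: prodn_gt0 => i; exact: fact_gt0. Qed.

Lemma ncoeff_eq0 f m : (ncoeff f m == 0) = (f@_m == 0).
Proof. by rewrite mulrn_eq0 eqn0Ngt mnm_fact_gt0. Qed.

Lemma ncoeff_ge0 f m : (0 <= ncoeff f m) = (0 <= f@_m).
Proof. by rewrite pmulrn_lge0 // mnm_fact_gt0. Qed.

Lemma ncoeff_deriv i f m : ncoeff (mderiv i f) m = ncoeff f (m + U_(i)).
Proof.
rewrite /ncoeff mcoeff_deriv -mulrnA; congr (_ *+ _).
rewrite /mnm_fact (bigD1 i) //= [RHS](bigD1 i) //= mnmDE mnm1E eqxx addn1 factS mulnA.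
congr (_ * _)%N; apply: eq_bigr => j ji.
by rewrite mnmDE mnm1E eq_sym (negPf ji) addn0.
Qed.

Lemma ncoeff_derivs (s : seq 'I_k) f m :
  ncoeff (foldr (fun i g => mderiv i g) f s) m =
  ncoeff f (m + \sum_(i <- s) U_(i))%MM.
Proof.
elim: s m => [|i s IHs] m /=; first by rewrite big_nil addm0.
by rewrite ncoeff_deriv IHs big_cons addmA.
Qed.

Lemma hessianE f i j : hessian f i j = ncoeff f (U_(i) + U_(j)).
Proof.
rewrite mxE -[LHS]mulr1n.
have <- : mnm_fact 0 = 1%N by apply: big1 => l _; rewrite mnm0E.
rewrite -/(ncoeff _ _) !ncoeff_deriv; congr ncoeff.
by rewrite add0m addmC.
Qed.

End NormalizedCoefficients.

(** Cauchy-Schwarz, from the nonnegativity of the variance. *)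
Lemma big_sqr_le (R : realType) (I : finType) (B : {set I}) (F : I -> R) :
  (\sum_(i in B) F i) ^+ 2 <= #|B|%:R * \sum_(i in B) F i ^+ 2.
Proof.
set X := \sum_(i in B) F i; set Q := \sum_(i in B) F i ^+ 2.
have [/eqP|B_gt0] := posnP #|B|.
  by rewrite cards_eq0 => /eqP B0; rewrite /X B0 big_set0 expr0n /= cards0 mul0r.
have : 0 <= \sum_(i in B) (#|B|%:R * F i - X) ^+ 2 by apply: sumr_ge0 => i _; exact: sqr_ge0.
have -> : \sum_(i in B) (#|B|%:R * F i - X) ^+ 2 = #|B|%:R * (#|B|%:R * Q - X ^+ 2).
  transitivity (\sum_(i in B) (#|B|%:R ^+ 2 * F i ^+ 2 - 2 * #|B|%:R * X * F i + X ^+ 2)).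
    by apply: eq_bigr => i _; ring.
  rewrite big_split sumrB /= -!mulr_sumr -/X -/Q sumr_const; ring.
by rewrite pmulr_rge0 ?ltr0n // subr_ge0.
Qed.

(** Multiply by [s0] and complete the square: the square vanishes on the hyperplane, and
    [s0 * s2 * (X ^ 2 - Q) <= s1 ^ 2 * X ^ 2] remains. *)
Lemma quadratic_le0 (R : realType) (b : nat) (s0 s1 s2 X Y Q W : R) :
  0 <= s2 -> s2 <= s1 -> s1 <= s0 -> (b%:R - 1) * (s2 * s0) <= b%:R * s1 ^+ 2 ->
  X ^+ 2 <= b%:R * Q -> 0 <= Q -> 0 <= W -> s1 * X + s0 * Y = 0 ->
  s2 * (X ^+ 2 - Q) + 2 * s1 * (X * Y) + s0 * Y ^+ 2 + (s1 - s0) * W <= 0.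
Proof.
move=> s2_ge0 s21 s10 lc cs Q_ge0 W_ge0 XY0.
have W_le : (s1 - s0) * W <= 0 by rewrite mulr_le0_ge0 // subr_le0.
suff : s2 * (X ^+ 2 - Q) + 2 * s1 * (X * Y) + s0 * Y ^+ 2 <= 0 by lra.
have [s0_le0|s0_gt0] := lerP s0 0.
  have [-> [-> ->]] : s0 = 0 /\ s1 = 0 /\ s2 = 0 by lra.
  by rewrite !(mul0r, mulr0, addr0).
rewrite -(pmulr_rle0 _ s0_gt0).
have -> : s0 * (s2 * (X ^+ 2 - Q) + 2 * s1 * (X * Y) + s0 * Y ^+ 2) =
  (s1 * X + s0 * Y) ^+ 2 + (s0 * s2 * (X ^+ 2 - Q) - s1 ^+ 2 * X ^+ 2) by ring.
rewrite XY0 expr0n /= add0r subr_le0.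
have X2_ge0 := sqr_ge0 X; have s1_ge0 := sqr_ge0 s1.
have s02_ge0 : 0 <= s0 * s2 by rewrite mulr_ge0 // ltW.
case: b => [|b] in lc cs *.
  have X0 : X ^+ 2 = 0 by lra.
  by rewrite X0 mulr0 sub0r mulrN oppr_le0 mulr_ge0.
(* Scaled by the size [b.+1], the bound [cs] on [X ^ 2] turns the left side into at most
   [b * s0 * s2 * X ^ 2], where [lc] applies. *)
rewrite -(ler_pM2l (ltr0Sn R b)).
have h1 : s0 * s2 * X ^+ 2 <= s0 * s2 * (b.+1%:R * Q) by rewrite ler_wpM2l.
have h2 := ler_wpM2r X2_ge0 lc.
nra.
Qed.

Section TwoBounded.
Variable k : nat.
Implicit Types (m al be : 'X_{1..k}) (i j c : 'I_k).

Definition bounded2 m : bool := [forall c, (m c <= 2)%N].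
Definition twos m : nat := #|level m 2|.

Lemma bounded2U m i : bounded2 (m + U_(i)) = bounded2 m && (m i < 2)%N.
Proof.
apply/forallP/andP => [mU|[/forallP m2 mi] c].
  split; last by have := mU i; rewrite mnmDE mnm1E eqxx addn1.
  apply/forallP => c; apply: leq_trans (mU c).
  by rewrite mnmDE leq_addr.
by rewrite mnmDE mnm1E; case: eqVneq => [<-|_]; rewrite ?addn1 ?addn0.
Qed.

Lemma twosU m i : (m i < 2)%N -> twos (m + U_(i)) = (twos m + (m i == 1))%N.
Proof.
rewrite /twos /level => mi.
rewrite [LHS](cardsD1 i) [in RHS](cardsD1 i) !inE mnmDE mnm1E eqxx addn1 eqSS.
rewrite [m i == 2](ltn_eqF mi) addnC; congr (_ + _)%N; apply: eq_card => c.
by rewrite !inE mnmDE mnm1E eq_sym; case: eqVneq; rewrite ?addn0.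
Qed.

Lemma mdeg_twos m : bounded2 m -> mdeg m = (#|[set c | m c != 0%N]| + twos m)%N.
Proof.
move=> /forallP m2; rewrite mdegE /twos -!sum1_card.
rewrite [X in (X + _)%N]big_mkcond [X in (_ + X)%N]big_mkcond -big_split.
by apply: eq_bigr => c _ /=; rewrite !inE; case: (m c) (m2 c) => [|[|[|]]].
Qed.

(** Any [j] with [al j < be j] keeps the degree and the bound 2; the choice of [j] only has to keep
    the number of twos admissible for [p]. *)
Lemma M_convex_twos n (J : {pred 'X_{1..k}}) (p : pred nat) :
  (forall a b, (a <= b)%N -> p b -> p a) ->
  (forall m, (m \in J) = [&& bounded2 m, mdeg m == n & p (twos m)]) ->
  M_convex J.
Proof.
move=> p_down JE al be; rewrite !JE => /and3P[al2 /eqP dal pal] /and3P[be2 /eqP dbe pbe] i lt_i.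
pose al' := (al - U_(i))%MM.
have alE : al = (al' + U_(i))%MM by rewrite submK // lep1mP; lia.
have al'c c : c != i -> al' c = al c.
  by move=> ci; rewrite mnmBE mnm1E eq_sym (negPf ci) subn0.
have [al'2 al'i] : bounded2 al' /\ (al' i < 2)%N by apply/andP; rewrite -bounded2U -alE.
have al'iE : al i = (al' i).+1 by rewrite {1}alE mnmDE mnm1E eqxx addn1.
have twos_al : twos al = (twos al' + (al' i == 1))%N by rewrite {1}alE twosU.
suff [j [lt_j le_two]] : exists j, (al j < be j)%N /\
    p (twos al' + (al j == 1))%N.
  have ji : j != i by apply: contraTneq lt_j => ->; rewrite -leqNgt ltnW.
  have bej := forallP be2 j.
  have al'j : (al' j < 2)%N by rewrite al'c //; lia.
  exists j; split=> //; rewrite JE -/al' bounded2U al'2 al'j twosU // al'c // le_two.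
  by rewrite -dal {1}alE !mdegD !mdeg1 eqxx.
have [j0 lt_j0] : exists j, (al j < be j)%N.
  apply/existsP; apply: contraPT (dal) => /existsPn le_ba.
  suff : (mdeg be < mdeg al)%N by lia.
  rewrite !mdegE (bigD1 i) //= [ltnRHS](bigD1 i) //= -addSn leq_add // leq_sum // => j _.
  by rewrite leqNgt le_ba.
(* If [al i = 2], the exchange destroys a two, so any [j] will do. *)
have [al'i1|al'i1] := eqVneq (al' i) 1%N.
  exists j0; split=> //; apply: p_down pal; rewrite twos_al al'i1 leq_add2l.
  exact: leq_b1.
rewrite twos_al (negPf al'i1) addn0 in pal.
have [/existsP[j /andP[lt_j alj]]|/existsPn no_j] :=
    boolP [exists j, (al j < be j)%N && (al j == 0%N)].
  by exists j; split=> //; rewrite (eqP alj) addn0.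
(* Now the support of [be] is strictly inside that of [al]; as the degrees agree, [be] has more twos
   than [al], which leaves room for one new two. *)
exists j0; split=> //; apply: p_down pbe.
have : (#|[set c | be c != 0%N]| < #|[set c | al c != 0%N]|)%N.
  apply: proper_card; apply/properP; split.
    apply/subsetP => c; rewrite !inE; have := no_j c; lia.
  by exists i; rewrite !inE; lia.
have := mdeg_twos al2; have := mdeg_twos be2; rewrite twos_al dal dbe.
by case: (al j0 == 1%N); case: (al' i == 1%N) al'i1; lia.
Qed.

End TwoBounded.

(** To be used with [B] and [Z] the places where the exponent of the derivative is 1 and 0. The last
    summand corrects the diagonal: it becomes 0 on [B], where an exponent would reach 3, and [s1] on
    [Z], where a single two arises. *)
Lemma block_form_sum (R : realType) (k : nat) (B Z : {set 'I_k})
    (s0 s1 s2 : R) (H : 'M[R]_k) (x : 'rV[R]_k) :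
  let X := \sum_(i in B) x 0 i in let Y := \sum_(i in Z) x 0 i in
  let Q := \sum_(i in B) x 0 i ^+ 2 in let W := \sum_(i in Z) x 0 i ^+ 2 in
  (forall i j, H i j =
     s2 * ((i \in B)%:R * (j \in B)%:R) +
     s1 * ((i \in B)%:R * (j \in Z)%:R + (i \in Z)%:R * (j \in B)%:R) +
     s0 * ((i \in Z)%:R * (j \in Z)%:R) +
     (i == j)%:R * ((s1 - s0) * (i \in Z)%:R - s2 * (i \in B)%:R)) ->
  (x *m H *m x^T) 0 0 =
  s2 * (X ^+ 2 - Q) + 2 * s1 * (X * Y) + s0 * Y ^+ 2 + (s1 - s0) * W.
Proof.
move=> X Y Q W HE; rewrite mxE.
pose b i := (i \in B)%:R * x 0 i; pose z i := (i \in Z)%:R * x 0 i.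
have indicator (D : {set 'I_k}) (F : 'I_k -> R) : \sum_(i in D) F i =
    \sum_i (i \in D)%:R * F i.
  by rewrite big_mkcond; apply: eq_bigr => i _; case: ifP; rewrite ?mul1r ?mul0r.
have XE : X = \sum_i b i := indicator B _.
have YE : Y = \sum_i z i := indicator Z _.
have QE : Q = \sum_i (i \in B)%:R * x 0 i ^+ 2 := indicator B _.
have WE : W = \sum_i (i \in Z)%:R * x 0 i ^+ 2 := indicator Z _.
transitivity (\sum_j \sum_i (s2 * (b i * b j) + s1 * (b i * z j) + s1 * (z i * b j) +
    s0 * (z i * z j) + (i == j)%:R * ((s1 - s0) * ((i \in Z)%:R * x 0 i ^+ 2) -
    s2 * ((i \in B)%:R * x 0 i ^+ 2)))).
  apply: eq_bigr => j _; rewrite !mxE mulr_suml; apply: eq_bigr => i _.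
  rewrite HE /b /z; case: eqVneq => [<-|_] /=; ring.
have dbl (F G : 'I_k -> R) : \sum_j \sum_i F i * G j = (\sum_i F i) * (\sum_i G i).
  by rewrite exchange_big /= big_distrlr.
have diag (F : 'I_k -> R) : \sum_j \sum_i (i == j)%:R * F i = \sum_i F i.
  apply: eq_bigr => j _; rewrite (bigD1 j) //= eqxx mul1r big1 ?addr0 // => i /negPf->.
  by rewrite mul0r.
under eq_bigr do rewrite !big_split /= -!mulr_sumr.
rewrite !big_split /= -!mulr_sumr !dbl diag sumrB -!mulr_sumr -XE -YE -QE -WE.
ring.
Qed.

Lemma lorentzian_twos (R : realType) k n (f : {mpoly R[k]}) (s : nat -> nat) :
  (forall m, ncoeff f m =
     if bounded2 m && (mdeg m == n) then (s (twos m))%:R else 0) ->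
  (forall a, s a.+1 <= s a)%N ->
  (forall a, (n - a.*2 - 3) * (s a.+2 * s a) <= (n - a.*2 - 2) * s a.+1 ^ 2)%N ->
  lorentzian n f.
Proof.
move=> fE s_dec s_lc.
have coeff_neq0 m : (f@_m != 0) = [&& bounded2 m, mdeg m == n & s (twos m) != 0%N].
  by rewrite -ncoeff_eq0 fE andbA; case: ifP; rewrite ?eqxx // pnatr_eq0.
split.
- apply/dhomogP => m; rewrite mcoeff_msupp coeff_neq0.
  by case/and3P=> _ /eqP.
- by move=> m; rewrite -ncoeff_ge0 fE; case: ifP.
- apply: (@M_convex_twos _ n _ (fun a => s a != 0%N)) => [a b ab|m].
    rewrite -!lt0n => /leq_trans; apply.
    rewrite -(subnKC ab); elim: (b - a)%N => [|d IHd]; first by rewrite addn0.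
    by rewrite addnS (leq_trans (s_dec _)) //.
  by rewrite inE coeff_neq0.
move=> l size_l; set H := hessian _.
pose g := (\sum_(i <- l) U_(i))%MM : 'X_{1..k}.
pose a := twos g; pose B := level g 1; pose Z := level g 0.
have deg_g : mdeg g = size l.
  by rewrite /g; elim: (l) => [|i l' IHl]; rewrite ?big_nil ?mdeg0 // big_cons mdegD mdeg1 IHl.
have HE i j : H i j = ncoeff f (g + U_(i) + U_(j)).
  by rewrite /H hessianE ncoeff_derivs -/g addmC addmA.
have H_sym : H^T = H by apply/matrixP => i j; rewrite mxE !HE -addmA [(U_(j) + _)%MM]addmC addmA.
(* If some variable is differentiated more than twice, the Hessian is zero. *)
have [g2|gN2] := boolP (bounded2 g); last first.
  apply: (@num_pos_eigenvalues_le1 _ _ _ 0) => // x _.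
  have -> : H = 0.
    by apply/matrixP => i j; rewrite HE fE !bounded2U (negPf gN2) mxE.
  by rewrite mulmx0 mul0mx mxE.
have Hs i j : H i j =
     (s a.+2)%:R * ((i \in B)%:R * (j \in B)%:R) +
     (s a.+1)%:R * ((i \in B)%:R * (j \in Z)%:R + (i \in Z)%:R * (j \in B)%:R) +
     (s a)%:R * ((i \in Z)%:R * (j \in Z)%:R) +
     (i == j)%:R * (((s a.+1)%:R - (s a)%:R) * (i \in Z)%:R - (s a.+2)%:R * (i \in B)%:R).
  rewrite HE fE !bounded2U g2 /= !mdegD !mdeg1 deg_g !addn1 size_l eqxx andbT.
  rewrite mnmDE mnm1E !inE.
  case: ifP => [/andP[gi gij]|gN].
    rewrite !twosU ?mnmDE ?mnm1E // -/a.
    case: (eqVneq i j) gij => [<-|_].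
      by case: (g i) gi => [|[|]] //= _; rewrite ?addn0 ?addn1 => // _; ring.
    by case: (g i) gi => [|[|]] // _; case: (g j) => [|[|]] //= _; rewrite ?addn0 ?addn1; ring.
  move: gN; case: (eqVneq i j) => [<-|_].
    by case: (g i) => [|[|?]] //= _; ring.
  by case: (g i) => [|[|?]]; case: (g j) => [|[|?]] //= _; ring.
(* The hyperplane is the zero set of the linear form whose square is completed in
   [quadratic_le0]. *)
apply: (@num_pos_eigenvalues_le1 _ _ _
    (\row_i ((s a.+1)%:R * (i \in B)%:R + (s a)%:R * (i \in Z)%:R))) => // x xw.
rewrite (block_form_sum _ Hs); apply: (@quadratic_le0 _ #|B|).
- by [].
- by rewrite ler_nat.
- by rewrite ler_nat.
- have := s_lc a.
  have -> : n = (#|B| + a.*2 + 2)%N.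
    rewrite -size_l -deg_g mdegE sum_level //; last exact/forallP.
    by rewrite /a /twos -/B; lia.
  have -> : (#|B| + a.*2 + 2 - a.*2 - 2 = #|B|)%N by lia.
  have -> : (#|B| + a.*2 + 2 - a.*2 - 3 = #|B| - 1)%N by lia.
  (* For empty [B] the truncated [#|B| - 1] is 0 but the real coefficient is -1, hence the separate
     case. *)
  case: #|B| => [|b] le_b; first by rewrite mul0r sub0r mulN1r oppr_le0 mulr_ge0.
  have -> : b.+1%:R - 1 = b%:R :> R by rewrite -natr1 addrK.
  by move: le_b; rewrite subn1 /= -natrX -!natrM ler_nat.
- exact: big_sqr_le.
- by apply: sumr_ge0 => i _; exact: sqr_ge0.
- by apply: sumr_ge0 => i _; exact: sqr_ge0.
transitivity ((0 : 'M[R]_1) 0 0); last by rewrite mxE.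
rewrite -xw mxE !mulr_sumr ![\sum_(i in _) _]big_mkcond -big_split /=; apply: eq_bigr => i _.
rewrite !mxE; case: (i \in B); case: (i \in Z) => /=; ring.
Qed.

(** * Abelian Dyck paths *)

Lemma mnm_fact_bounded2 k (m : 'X_{1..k}) :
  bounded2 m -> mnm_fact m = (2 ^ twos m)%N.
Proof.
move=> /forallP m2; rewrite /mnm_fact /twos -prod_nat_const [RHS]big_mkcond /=.
by apply: eq_bigr => i _; rewrite !inE; case: (m i) (m2 i) => [|[|[|]]].
Qed.

Lemma mcoeff_chromatic (R : realType) (V : finType) (e : rel V) k (m : 'X_{1..k}) :
  (chromatic_symmetric R e k)@_m =
  #|[set f : {ffun V -> 'I_k} |
     proper_coloring e f & [forall c, content f c == m c]]|%:R.
Proof.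
rewrite /chromatic_symmetric raddf_sum /= -sum1_card natr_sum.
rewrite big_mkcond [RHS]big_mkcond /=; apply: eq_bigr => f _; rewrite inE.
case: proper_coloring => //=.
have -> : \prod_v 'X_(f v) = 'X_[R, (\sum_v U_(f v))%MM] by rewrite mprodXE.
rewrite mcoeffX; have -> : ((\sum_v U_(f v))%MM == m) = [forall c, content f c == m c].
  apply/eqP/forallP => [<- c|fm].
    apply/eqP; rewrite mnm_sumE /content -sum1_card big_mkcond.
    by apply: eq_bigr => v _; rewrite inE mnm1E; case: eqP.
  apply/mnmP => c; rewrite mnm_sumE -(eqP (fm c)) /content -sum1_card [RHS]big_mkcond.
  by apply: eq_bigr => v _; rewrite inE mnm1E; case: eqP.
by case: ifP.
Qed.

Lemma chromatic_lorentzian (R : realType) (V : finType) (e : rel V) (A : {set V}) k :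
  (0 < k)%N -> ssrbool.symmetric e -> irreflexive e ->
  {in A &, forall u v, u != v -> e u v} ->
  {in ~: A &, forall u v, u != v -> e u v} ->
  (forall U : {set V}, U != set0 -> exists2 v, v \in U &
     if v \in A then {in U, forall u, u != v -> e u v}
     else {in U, forall u, u \in A -> ~~ e u v}) ->
  lorentzian #|V| (chromatic_symmetric R e k).
Proof.
(* A positive number of colours supplies the dummy colour. *)
case: k => // k _ e_sym e_irrefl A_clique B_clique peel.
have [t rt tP] := card_proper_content (ord0 : 'I_k.+1) e_sym e_irrefl A_clique B_clique peel.
have cV : #|V| = (#|~: A| + #|A|)%N by rewrite addnC cardsC.
apply: (@lorentzian_twos _ _ _ _ (weight #|~: A| #|A| t)) => [m|a|a].
- rewrite /ncoeff mcoeff_chromatic /proper_coloring tP -/(bounded2 m) -mdegE.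
  case: ifP => [/andP[m2 _]|_]; last by rewrite mul0rn.
  rewrite mnm_fact_bounded2 // -mulrnA /weight -/(twos m).
  by case: ifP => _; rewrite ?mul0n // mulnC.
- exact: weight_dec.
- by rewrite cV; exact: weight_log_concave.
Qed.

Lemma norths_before_east_homo w i j :
  (i <= j)%N -> (norths_before_east w i <= norths_before_east w j)%N.
Proof.
elim: w i j => [|[] w IHw] //= [|i] [|j] //= ij; first exact: IHw.
Qed.

Section AbelianPaths.
Variables (n : nat) (d : dyck_path n).
Hypothesis d_abelian : abelian_dyck d.
Local Notation h := (norths_before_east d).
Local Notation e := (indiff_graph d).

(** A path starting with [East] would drop below the diagonal at once. *)
Lemma hessenberg0_gt0 : (0 < n)%N -> (0 < h 0)%N.
Proof.
move=> n_gt0; have := dyck_above d 1; have := dyck_norths d.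
by case: (dyck_steps d) => [n0|[] w n0] /=; rewrite ?take0 //; move: n_gt0; rewrite -n0.
Qed.

(** Vertex 0 and its neighbours. *)
Definition initial_clique : {set 'I_n} := [set i : 'I_n | (i < h 0)%N].
Local Notation A := initial_clique.

(** The Hessenberg function is nondecreasing, so its value at each vertex is at least [h 0], which
    exceeds both labels. *)
Lemma initial_cliqueP : {in A &, forall u v, u != v -> e u v}.
Proof.
move=> u v; rewrite !inE => uA vA uv.
have := norths_before_east_homo d (leq0n u).
have := norths_before_east_homo d (leq0n v).
move: uv; rewrite /indiff_graph /hessenberg -val_eqE /=; lia.
Qed.

(** Two non-adjacent vertices outside [A] would form, with vertex 0, a triangle in the bipartite
    complement. *)
Lemma final_cliqueP : {in ~: A &, forall u v, u != v -> e u v}.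
Proof.
move=> u v; rewrite !inE -!leqNgt => uA vA uv; case: d_abelian => X XP.
have n_gt0 : (0 < n)%N by case: (n) u {uA uv} => // -[].
pose z := Ordinal n_gt0.
have compl_z (i : 'I_n) : (h 0 <= i)%N -> graph_compl e z i.
  have := hessenberg0_gt0 n_gt0.
  rewrite /graph_compl /indiff_graph /hessenberg -val_eqE /=; lia.
have zu := XP _ _ (compl_z _ uA); have zv := XP _ _ (compl_z _ vA).
apply: contraT => not_e; have /XP : graph_compl e u v by rewrite /graph_compl uv.
by move: zu zv; case: (z \in X); case: (u \in X); case: (v \in X).
Qed.

(* [u] in the first clique and [v] in the second are adjacent iff
[v < h u], so comparing the keys [2 * h u] and [2 * v + 1] sorts the two
cliques into a staircase. *)
Lemma peelable (U : {set 'I_n}) : U != set0 -> exists2 v, v \in U &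
  if v \in A then {in U, forall u, u != v -> e u v}
  else {in U, forall u, u \in A -> ~~ e u v}.
Proof.
case/set0Pn => u0 u0U.
pose key (v : 'I_n) := if v \in A then (h v).*2 else v.*2.+1.
(* For [v] in [A] of maximal key, [u < h v] for each [u] of [U] outside [A]; for [v] outside [A],
   [h u <= v] for each [u] of [U] in [A]. *)
have [v vU v_max] := @arg_maxnP _ u0 (mem U) key u0U.
exists v => //; case: ifPn => vA u uU.
  have [uA uv|uA uv] := boolP (u \in A); first exact: initial_cliqueP.
  have := v_max u uU; rewrite /key vA (negPf uA).
  move: uA vA; rewrite !inE /indiff_graph /hessenberg; lia.
move=> uA; have := v_max u uU; rewrite /key uA (negPf vA).
move: uA vA; rewrite !inE /indiff_graph /hessenberg; lia.
Qed.

End AbelianPaths.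

Local Close Scope ring_scope.

Theorem theorem1p5 (R : realType) (n : nat) (d : dyck_path n)
  (d_abelian : abelian_dyck d) (k : nat) (k_ge1 : 1 <= k) :
  lorentzian n (chromatic_symmetric R (indiff_graph d) k).
Proof.
rewrite -[n in lorentzian n](card_ord n).
apply: (@chromatic_lorentzian _ _ _ (initial_clique d)) => //.
- exact: indiff_graph_sym.
- exact: indiff_graph_irrefl.
- exact: initial_cliqueP.
- exact: final_cliqueP.
- exact: peelable.
Qed.
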